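(* Let $c$ be a maximal congruence and let $(\dot c^\varphi)_{\varphi\in\mathbb S^1}$ be an associated family of null congruences of $c$. Then the $X$-variables $X_\circ(w)$, $w\in\mathbb Z^2_\circ$, of $\dot c^\varphi$ do not depend on $\varphi$.
   Context: **Lorentz sphere geometry.** $\mathbb R^{2,1}$ is $\mathbb R^3$ with $\langle x,y\rangle=x_1y_1+x_2y_2-x_3y_3$; $|x|=\sqrt{\langle x,x\rangle}$ for spacelike $x$. The Lorentz cross product is defined by $\langle x\times y,z\rangle=\det(x,y,z)$. $\mathbf U_+=\{x:\langle x,x\rangle=-1,\ x_3>0\}$. An oriented sphere has a centre $m$ and a signed radius $R\in\mathbb R$ and underlying set $\{x:\langle x-m,x-m\rangle=R^2\}$; it is an oriented timelike sphere if $R\ne0$ and a null-sphere (with apex $m$) if $R=0$. An oriented isotropic line is a line $\{p+sv\}$ with $\langle v,v\rangle=0$, $v\neq0$, together with an orientation of the direction $v=(v',v_3)$; let $\nu=(Jv'/|v'|,0)$ with $J$ the rotation of $\mathbb R^2$ by $\pi/2$. The oriented sphere $(m,R)$ is in oriented contact with this line if $p-m\in R\nu+\mathbb Rv$; for $R\neq 0$ this means that the line is contained in the sphere with compatible orientation, for $R=0$ that it passes through the apex. Two oriented timelike spheres $(m,R),(m',R')$ are in oriented contact if they touch and $\langle m-m',m-m'\rangle=(R-R')^2$. A spacelike circle is the intersection of a sphere with a spacelike plane. **Combinatorics.** $\mathbb Z^2$ is bipartitioned into black vertices $\mathbb Z^2_\bullet$ ($z_1+z_2$ even) and white vertices $\mathbb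 Z^2_\circ$ ($z_1+z_2$ odd). Each face of $\mathbb Z^2$ has two white and two black vertices; two white vertices of a common face are called adjacent. White edges in direction $(1,1)$ are called horizontal, those in direction $(1,-1)$ vertical. **Contact and null congruences.** A contact congruence $c$ assigns to each vertex $v\in\mathbb Z^2$ an oriented timelike sphere or a null-sphere $c(v)$ and to each face $f$ of $\mathbb Z^2$ an oriented isotropic line $c(f)$, such that $c(v)$ is in oriented contact with $c(f)$ whenever $v$ and $f$ are incident. It is a null congruence if $c(w)$ is an oriented timelike sphere for every white vertex $w$ and $c(b)$ is a null-sphere for every black vertex $b$. Its center net is ${\odot c}:\mathbb Z^2\to\mathbb R^{2,1}$, where ${\odot c}(v)$ is the centre of $c(v)$. A null congruence is isothermic if for every black vertex the centres of the four spheres at the adjacent white vertices lie in a spacelike plane. **$X$-variables.** Let $c$ be a null congruence and let $\pi:\mathbb R^{2,1}\to\mathbb C$, $\pi(x)=x_1+ix_2$, be the orthogonal projection to the Euclidean plane. The projection of $c$ is an incircular net, with incircle centres $p_w=\pi({\odot c}(w))$, $w$ white, and vertices $p_b=\pi({\odot c}(b))$, $b$ black. The $X$-variables of $c$ (of its incircular net) are $$X_\circ(w)=-\frac{(p_{b_1}-p_w)(p_{b_3}-p_w)}{(p_{b_2}-p_w)(p_{b_4}-p_w)}\in\mathbb R,$$ for $w\in\mathbb Z^2_\circ$ with adjacent black vertices $b_1=w+(1,0),b_2,b_3,b_4$ in counterclockwise order. **S-isothermic and Koebe isothermic nets.** A (spacelike Lorentz) S-isothermic net $h$ assigns to each white vertex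 $w$ an oriented timelike sphere $h(w)$, to each black vertex $b$ a spacelike circle $h(b)$, and to each face $f$ a point $h(f)$, such that for all faces $f=(w,b,w',b')$ the spheres $h(w),h(w')$ are in oriented contact and the circles $h(b),h(b')$ intersect the two spheres orthogonally in the point $h(f)$. ${\odot h}_\circ(w)$ denotes the centre of $h(w)$. It is a Koebe isothermic net if all circles $h(b)$ lie in $\mathbf U_+$; equivalently, it arises from an orthogonal circle pattern of spacelike circles on $\mathbf U_+$ (a circle at each vertex of $\mathbb Z^2$, adjacent circles orthogonal, the four circles around each face meeting in a point), $h(b)$ being the black circle and $h(w)$ the timelike sphere meeting $\mathbf U_+$ orthogonally in the white circle. $R(w)>0$ denotes the (unsigned) radius of $h(w)$; for adjacent $w,w'$ sharing the face $f$ the point $h(f)\in\mathbf U_+$ lies between the centres, so $|{\odot h}_\circ(w')-{\odot h}_\circ(w)|=R(w)+R(w')$. **Associated family of nets.** For a face $f$ with white vertices $w,w'$ let $N=h(f)$, $T=({\odot h}_\circ(w')-{\odot h}_\circ(w))/|{\odot h}_\circ(w')-{\odot h}_\circ(w)|$, $B=T\times N$, $T^\varphi=T\cos\varphi+B\sin\varphi$ and $B^\varphi=-T\sin\varphi+B\cos\varphi$. The net ${\odot h}_\circ^\varphi:\mathbb Z^2_\circ\to\mathbb R^{2,1}$ is defined up to translation by $${\odot h}_\circ^\varphi(w')-{\odot h}_\circ^\varphi(w)=\pm\big(R(w)^{-1}+R(w')^{-1}\big)T^\varphi$$ with $+$ for horizontal and $-$ for vertical white edges (these increments are consistent around every black vertex).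 The spheres $h_\circ^\varphi(w)$ are the timelike spheres with centres ${\odot h}_\circ^\varphi(w)$ and radii $R(w)^{-1}$; spheres at adjacent white vertices touch, and they are oriented such that spheres at adjacent white vertices are in oriented contact. For $\varphi=0$ these are the spheres of the Christoffel dual $h^*$ of $h$. **Maximal congruence.** An isothermic congruence $c$ whose Christoffel dual is a Koebe congruence; equivalently, there is a Koebe isothermic net $h$ such that the white spheres of $c$ are the spheres $h_\circ^0$ of the Christoffel dual $h^*$. Fix this $h$. **Associated congruences and null congruences.** At the contact point of the two spheres $h_\circ^\varphi(w),h_\circ^\varphi(w')$ at a face $f$ there are exactly two isotropic lines contained in both spheres, with directions $N\pm B^\varphi$. For a black vertex $b$ with adjacent white vertices $w_1,\dots,w_4$ in cyclic order, let $f_i$ be the face containing $b,w_i,w_{i+1}$ and let $G^\varphi_{i,\pm}$ be the line at $f_i$ with direction $N\pm B^\varphi$, computed with $T$ pointing from $w_i$ to $w_{i+1}$. The four lines $G^\varphi_{1,+},G^\varphi_{2,-},G^\varphi_{3,+},G^\varphi_{4,-}$ lie in a common sphere of radius $\sin\varphi$, and so do $G^\varphi_{1,-},G^\varphi_{2,+},G^\varphi_{3,-},G^\varphi_{4,+}$. Choosing one of these two quadruples at one black vertex (the same choice for all $\varphi$) determines a consistent choice at all black vertices, and yields two families of contact congruences $(c^1)^\varphi,(c^2)^\varphi$ (the associated congruences), with $h_\circ^\varphi$ at the white vertices, the chosen spheres at the black vertices and the chosen lines at the faces. For each associated congruence $c^\varphi$, all spheres at black vertices have the same signed radius $\rho_\varphi$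 (of absolute value $|\sin\varphi|$), and subtracting $\rho_\varphi$ from the signed radii of all spheres while keeping the centres gives a null congruence $\dot c^\varphi$ with ${\odot\dot c}^\varphi={\odot c}^\varphi$. An associated family of null congruences of $c$ is either of the two families $(\dot c^1)^\varphi$, $(\dot c^2)^\varphi$ obtained in this way. *)

(* Defs.v *)
From HB Require Import structures.
From mathcomp Require Export all_boot all_order all_algebra.
From mathcomp Require Export reals trigo.
From mathcomp Require Export complex.
From mathcomp Require Import ring.
Set Implicit Arguments.
Unset Strict Implicit.
Unset Printing Implicit Defensive.
Import Order.TTheory GRing.Theory Num.Theory.
Local Open Scope ring_scope.
Local Open Scope complex_scope.

(** * The Lorentz space R^{2,1} *)

(* The coordinates x_1, x_2, x_3 of x are [x 0 0], [x 0 1], [x 0 2]. *)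
Definition lvec (R : realType) := 'rV[R]_3.

Section Lorentz.
Variable R : realType.
Implicit Types x y : lvec R.

Definition linner x y : R := x 0 0 * y 0 0 + x 0 1 * y 0 1 - x 0 2 * y 0 2.

Definition lnorm x : R := Num.sqrt (linner x x).

Definition mkvec (a b c : R) : lvec R := \row_j [:: a; b; c]`_j.

Definition lcross x y : lvec R :=
  mkvec (x 0 1 * y 0 2 - x 0 2 * y 0 1)
        (x 0 2 * y 0 0 - x 0 0 * y 0 2)
        (x 0 1 * y 0 0 - x 0 0 * y 0 1).

Definition Uplus x : Prop := linner x x = -1 /\ 0 < x 0 2.

Definition proj x : R[i] := x 0 0 +i* x 0 1.

End Lorentz.

(* The defining property of the Lorentz cross product. *)
Lemma lcross_det (R : realType) (x y z : lvec R) :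
  linner (lcross x y) z = \det (\matrix_(i < 3, j < 3) [:: x; y; z]`_i 0 j).
Proof.
rewrite (expand_det_row _ 0) !big_ord_recl big_ord0 /cofactor.
rewrite !(expand_det_row _ 0) !big_ord_recl !big_ord0 /cofactor !det_mx11.
rewrite /linner /lcross /mkvec !mxE /=.
repeat match goal with |- context [fun_of_matrix ?v 0 ?i] =>
  match i with
  | 0 => fail 1 | 1 => fail 1 | 2 => fail 1
  | _ => first [ rewrite (_ : i = 0); last exact: val_inj
               | rewrite (_ : i = 1); last exact: val_inj
               | rewrite (_ : i = 2); last exact: val_inj ]
  end end.
by ring.
Qed.

(** * Oriented spheres, oriented isotropic lines, spacelike circles *)

Record osphere (R : realType) := OSphere { centre : lvec R; srad : R }.

Record oline (R : realType) := OLine { lpoint : lvec R; ldir : lvec R }.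

(* The intersection of a sphere with the plane
   [linner cnormal x = coffset]. *)
Record lcircle (R : realType) :=
  LCircle { csphere : osphere R; cnormal : lvec R; coffset : R }.

Section Contact.
Variable R : realType.
Implicit Types (S : osphere R) (l : oline R) (C : lcircle R) (p q x t : lvec R).

Definition on_sphere S x : Prop :=
  linner (x - centre S) (x - centre S) = srad S ^+ 2.

Definition timelike_sphere S : Prop := srad S != 0.

Definition null_sphere S : Prop := srad S = 0.

(* An oriented isotropic line: the orientation is that of the direction vector,
   i.e. [OLine p v] and [OLine p (k *: v)] are the same oriented line exactly
   for k > 0. *)
Definition isotropic_line l : Prop := linner (ldir l) (ldir l) = 0 /\ ldir l != 0.

(* nu = (J v' / |v'|, 0). *)
Definition lnu (v : lvec R) : lvec R :=
  (Num.sqrt (v 0 0 ^+ 2 + v 0 1 ^+ 2))^-1 *: mkvec (- v 0 1) (v 0 0) 0.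

Definition line_contact S l : Prop :=
  exists s : R,
    lpoint l - centre S = srad S *: lnu (ldir l) + s *: ldir l.

(* The (unoriented) line underlying l is the line q + R d. *)
Definition is_line l q d : Prop :=
  (exists s : R, q = lpoint l + s *: ldir l) /\ (exists k : R, d = k *: ldir l).

(* p is a common point of S and S' with the same tangent plane: the normals
   p - m and p - m' are parallel. *)
Definition touch_at S S' p : Prop :=
  [/\ on_sphere S p, on_sphere S' p
    & exists k : R, p - centre S' = k *: (p - centre S)].

Definition sphere_contact S S' : Prop :=
  (exists p, touch_at S S' p) /\
  linner (centre S - centre S') (centre S - centre S')
    = (srad S - srad S') ^+ 2.

(* Any non-degenerate circle in a spacelike plane is cut out by a timelike
   sphere (e.g. the one centred in that plane); requiring [csphere] to be
   timelike only rules out the one-point intersection of the plane with a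
   null-sphere whose apex it contains. *)
Definition spacelike_circle C : Prop :=
  timelike_sphere (csphere C) /\ linner (cnormal C) (cnormal C) < 0.

Definition on_circle C x : Prop :=
  on_sphere (csphere C) x /\ linner (cnormal C) x = coffset C.

Definition tangent_circle C p t : Prop :=
  linner (cnormal C) t = 0 /\ linner (p - centre (csphere C)) t = 0.

(* At p the tangent line of C is spanned by the normal p - m of S. *)
Definition orthogonal_at C S p : Prop :=
  [/\ on_circle C p, on_sphere S p & tangent_circle C p (p - centre S)].

End Contact.

(** * Combinatorics of Z^2 *)

Definition vertex := (int * int)%type.

(* The face with corners f, f + (1,0), f + (1,1), f + (0,1) is represented by
   its lower left corner f. *)
Definition face := (int * int)%type.

Definition black (v : vertex) : bool := (2 %| v.1 + v.2)%Z.

Definition white (v : vertex) : bool := ~~ black v.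

Definition incident (v : vertex) (f : face) : bool :=
  v \in [:: f; f + (1, 0); f + (1, 1); f + (0, 1)].

(* w and w' are the two white vertices of the face f. *)
Definition white_edge (f : face) (w w' : vertex) : bool :=
  [&& white w, white w', w != w', incident w f & incident w' f].

(* White edges in direction +-(1,1) are horizontal, those in direction
   +-(1,-1) vertical. *)
Definition horizontal (w w' : vertex) : bool := (w' - w).1 == (w' - w).2.

(* The four neighbours of v in counterclockwise order, from v + (1,0) on. *)
Definition nbr (v : vertex) (i : 'I_4) : vertex :=
  v + nth 0 [:: (1, 0); (0, 1); (-1, 0); (0, -1)] i.

(* The face containing v, [nbr v i] and [nbr v (ordS i)]. *)
Definition nbr_face (v : vertex) (i : 'I_4) : face :=
  v + nth 0 [:: (0, 0); (-1, 0); (-1, -1); (0, -1)] i.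

(** * Contact congruences and null congruences *)

Record congruence (R : realType) :=
  Congruence { cs : vertex -> osphere R; cl : face -> oline R }.

Section Congruences.
Variable R : realType.
Implicit Type c : congruence R.

Definition contact_congruence c : Prop :=
  (forall f, isotropic_line (cl c f)) /\
  (forall v f, incident v f -> line_contact (cs c v) (cl c f)).

Definition null_congruence c : Prop :=
  [/\ contact_congruence c,
      forall w, white w -> timelike_sphere (cs c w)
    & forall b, black b -> null_sphere (cs c b)].

Definition center_net c (v : vertex) : lvec R := centre (cs c v).

Definition isothermic c : Prop :=
  forall b, black b ->
    exists (n : lvec R) (d : R),
      linner n n < 0 /\ forall i, linner n (center_net c (nbr b i)) = d.

Definition Xvar c (w : vertex) : R[i] :=
  let pw := proj (center_net c w) in
  let pb (i : 'I_4) := proj (center_net c (nbr w i)) in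
  - (((pb 0 - pw) * (pb 2 - pw)) / ((pb 1 - pw) * (pb 3 - pw))).

End Congruences.

(** * S-isothermic nets and Koebe isothermic nets *)

(* [hw] is only meaningful at white vertices, [hb] at black vertices. *)
Record snet (R : realType) := SNet {
  hw : vertex -> osphere R;
  hb : vertex -> lcircle R;
  hf : face -> lvec R }.

Section Nets.
Variable R : realType.
Implicit Type h : snet R.

Definition s_isothermic h : Prop :=
  [/\ forall w, white w -> timelike_sphere (hw h w),
      forall b, black b -> spacelike_circle (hb h b),
      forall f w w', white_edge f w w' -> sphere_contact (hw h w) (hw h w')
    & forall f w b, white w -> black b -> incident w f -> incident b f ->
        orthogonal_at (hb h b) (hw h w) (hf h f)].

(* The last clause: h(f) lies strictly between the two white centres. *)
Definition koebe_isothermic h : Prop :=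
  [/\ s_isothermic h,
      forall b, black b -> forall x, on_circle (hb h b) x -> Uplus x
    & forall f w w', white_edge f w w' ->
        exists t : R, [/\ 0 < t, t < 1 &
          hf h f = (1 - t) *: centre (hw h w) + t *: centre (hw h w')]].

Definition hrad h (w : vertex) : R := `|srad (hw h w)|.

Definition frameN h (f : face) : lvec R := hf h f.

Definition frameT h (w w' : vertex) : lvec R :=
  let d := centre (hw h w') - centre (hw h w) in (lnorm d)^-1 *: d.

Definition frameB h (f : face) (w w' : vertex) : lvec R :=
  lcross (frameT h w w') (frameN h f).

Definition frameTphi h (phi : R) (f : face) (w w' : vertex) : lvec R :=
  cos phi *: frameT h w w' + sin phi *: frameB h f w w'.

Definition frameBphi h (phi : R) (f : face) (w w' : vertex) : lvec R :=
  - sin phi *: frameT h w w' + cos phi *: frameB h f w w'.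

Definition edge_sign (w w' : vertex) : R := if horizontal w w' then 1 else -1.

(* The white spheres S(w) are the spheres h_o^phi(w) of the net associated
   with h; centres are determined up to a translation, orientations up to a
   simultaneous change. *)
Definition associated_spheres h (phi : R) (S : vertex -> osphere R) : Prop :=
  [/\ forall f w w', white_edge f w w' ->
        centre (S w') - centre (S w)
          = (edge_sign w w' * ((hrad h w)^-1 + (hrad h w')^-1))
              *: frameTphi h phi f w w',
      forall w, white w -> `|srad (S w)| = (hrad h w)^-1
    & forall f w w', white_edge f w w' -> sphere_contact (S w) (S w')].

(** * Maximal congruences and their associated families *)

(* The white spheres of c are those of the Christoffel dual of the Koebe
   isothermic net h. *)
Definition koebe_dual (c : congruence R) h : Prop :=
  koebe_isothermic h /\ associated_spheres h 0 (cs c).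

Definition maximal_congruence (c : congruence R) : Prop :=
  [/\ null_congruence c, isothermic c & exists h, koebe_dual c h].

(* c is an associated congruence of h at the angle phi. With w_i := nbr b i
   and f_i := nbr_face b i, the sign function s chooses at the black vertex b
   one of the two quadruples G_{1,+}, G_{2,-}, G_{3,+}, G_{4,-} (s b = false)
   and G_{1,-}, G_{2,+}, G_{3,-}, G_{4,+} (s b = true). As c has a single line
   at each face, s is determined by its value at one black vertex. *)
Definition associated_congruence h (s : vertex -> bool) (phi : R)
    (c : congruence R) : Prop :=
  [/\ contact_congruence c,
      associated_spheres h phi (cs c),
      forall b, black b -> `|srad (cs c b)| = `|sin phi|
    & forall b, black b -> forall i : 'I_4,
        let w := nbr b i in
        let w' := nbr b (ordS i) in
        let f := nbr_face b i in
        exists q, touch_at (cs c w) (cs c w') q /\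
          is_line (cl c f) q
            (frameN h f + (-1) ^+ (s b + i)%N *: frameBphi h phi f w w')].

(* cd is the null congruence obtained from c by subtracting the common signed
   radius of its black spheres from all signed radii. *)
Definition null_offset (c cd : congruence R) : Prop :=
  null_congruence cd /\
  exists rho : R,
    (forall b, black b -> srad (cs c b) = rho) /\
    (forall v, centre (cs cd v) = centre (cs c v) /\
               srad (cs cd v) = srad (cs c v) - rho).

(* The family cd is indexed by an angle phi in R. The choice s of the
   quadruples is the same for all phi. *)
Definition associated_null_family (c : congruence R)
    (cd : R -> congruence R) : Prop :=
  exists h, koebe_dual c h /\
    exists s : vertex -> bool, forall phi : R,
      exists2 cphi, associated_congruence h s phi cphi
                  & null_offset cphi (cd phi).

End Nets.

(* Main.v *)
(* Fix a white vertex w, put M = centre of h(w), r = its radius, and let T_i, N_i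
   be the frame vectors of the four faces around w, with T_i pointing away
   from w, so N_i = M + r T_i. The line of the congruence at the i-th face has
   the isotropic direction v_i = N_i + e B_i^phi with the same sign e for all
   i, and the centre of the i-th black sphere relative to that of w is the
   common point of two lines with directions v_{i-1}, v_i from opposite
   rulings of a one-sheeted hyperboloid. Projecting, X(w) becomes minus the
   cross-ratio of the four points of the circle at infinity given by the v_i,
   which is a rational function, homogeneous of degree 0, of the Gram matrix
   <v_i,v_j>. Finally <v_i,v_j> = (1 - e r sin phi)^2 (<T_i,T_j> - 1), so the
   dependence on phi is a common scalar factor. *)

Require Import Defs.
From mathcomp Require Import ring lra zify.
Set Implicit Arguments.
Unset Strict Implicit.
Unset Printing Implicit Defensive.
Import Order.TTheory GRing.Theory Num.Theory.
Local Open Scope ring_scope.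
Local Open Scope complex_scope.

(** * Algebra of the Lorentz product and of the rotated frames *)

Section LorentzAlgebra.
Variable R : realType.
Implicit Types x y z : lvec R.

Lemma lvecP x y : x 0 0 = y 0 0 -> x 0 1 = y 0 1 -> x 0 2 = y 0 2 -> x = y.
Proof.
move=> e0 e1 e2; apply/rowP; case=> [[|[|[|//]]] p].
- by move: e0; congr (x 0 _ = y 0 _); exact: val_inj.
- by move: e1; congr (x 0 _ = y 0 _); exact: val_inj.
- by move: e2; congr (x 0 _ = y 0 _); exact: val_inj.
Qed.

Lemma mkvecE (a b c : R) :
  (mkvec a b c 0 0 = a) * (mkvec a b c 0 1 = b) * (mkvec a b c 0 2 = c).
Proof. by rewrite /mkvec !mxE. Qed.

Definition coordE := (mkvecE, mxE).

Lemma linnerC x y : linner x y = linner y x.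
Proof. by rewrite /linner; ring. Qed.

Lemma linnerDl x y z : linner (x + y) z = linner x z + linner y z.
Proof. by rewrite /linner !coordE; ring. Qed.

Lemma linnerDr x y z : linner z (x + y) = linner z x + linner z y.
Proof. by rewrite /linner !coordE; ring. Qed.

Lemma linnerZl (a : R) x y : linner (a *: x) y = a * linner x y.
Proof. by rewrite /linner !coordE; ring. Qed.

Lemma linnerZr (a : R) x y : linner x (a *: y) = a * linner x y.
Proof. by rewrite /linner !coordE; ring. Qed.

Lemma linnerNl x y : linner (- x) y = - linner x y.
Proof. by rewrite -scaleN1r linnerZl mulN1r. Qed.

Lemma linnerNr x y : linner x (- y) = - linner x y.
Proof. by rewrite -scaleN1r linnerZr mulN1r. Qed.

Definition linnerE := (linnerDl, linnerDr, linnerZl, linnerZr, linnerNl, linnerNr).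

Lemma linner_crossr x y : linner y (lcross x y) = 0.
Proof. by rewrite /linner /lcross !coordE; ring. Qed.

Lemma linner_crossl x y : linner x (lcross x y) = 0.
Proof. by rewrite /linner /lcross !coordE; ring. Qed.

Lemma linner_cross x y z t :
  linner (lcross x y) (lcross z t)
  = linner x t * linner y z - linner x z * linner y t.
Proof. by rewrite /linner /lcross !coordE; ring. Qed.

Lemma linner_rotation (N T : lvec R) (c s : R) :
    linner T T = 1 -> linner N N = -1 -> linner T N = 0 ->
    c ^+ 2 + s ^+ 2 = 1 ->
  linner (c *: T + s *: lcross T N) (c *: T + s *: lcross T N) = 1.
Proof.
move=> TT NN TN cs.
transitivity (c ^+ 2 * linner T T + 2 * c * s * linner T (lcross T N)
  + s ^+ 2 * linner (lcross T N) (lcross T N)).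
  by rewrite /linner !coordE; ring.
rewrite linner_crossl linner_cross (linnerC N T) TT NN TN -[RHS]cs.
by ring.
Qed.

(** Used to see that the isotropic direction N + e B^phi is nonzero. *)
Lemma linner_frame_normal (N T : lvec R) (c s e : R) :
    linner N N = -1 -> linner T N = 0 ->
  linner N (N + e *: (- s *: T + c *: lcross T N)) = -1.
Proof.
move=> NN TN; rewrite !linnerE linner_crossr (linnerC N T) TN NN.
by rewrite !mulr0 addr0 mulr0 addr0.
Qed.

(** The frame satisfies B x N = -T and T x B = N, so the product can be expanded. The eigenvalue e
    tells apart the two isotropic lines through the contact point. *)
Lemma lcross_frame (N T : lvec R) (c s e : R) :
    linner T T = 1 -> linner N N = -1 -> linner T N = 0 ->
    c ^+ 2 + s ^+ 2 = 1 -> e ^+ 2 = 1 ->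
  let B := lcross T N in
  let v := N + e *: (- s *: T + c *: B) in
  lcross (c *: T + s *: B) v = e *: v.
Proof.
move=> TT NN TN cs ee B v.
have BN : lcross B N = - T.
  have -> : lcross B N = linner N N *: T - linner T N *: N.
    by apply: lvecP; rewrite /B /linner /lcross !coordE; ring.
  by rewrite NN TN scale0r subr0 scaleN1r.
have TB : lcross T B = N.
  have -> : lcross T B = linner T T *: N - linner T N *: T.
    by apply: lvecP; rewrite /B /linner /lcross !coordE; ring.
  by rewrite TT TN scale0r subr0 scale1r.
have -> : lcross (c *: T + s *: B) v
    = c *: B + s *: lcross B N + (e * (c ^+ 2 + s ^+ 2)) *: lcross T B.
  by apply: lvecP; rewrite /v {2}/B /lcross !coordE; ring.
rewrite BN TB cs mulr1.
have -> : e *: v = e *: N + (e ^+ 2) *: (c *: B - s *: T).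
  by apply: lvecP; rewrite /v !coordE; ring.
by rewrite ee scale1r; apply: lvecP; rewrite !coordE; ring.
Qed.

Lemma linner_frame_centre (M N T : lvec R) (r : R) :
    N = M + r *: T -> linner T T = 1 -> linner T N = 0 -> linner N N = -1 ->
  linner T M = - r /\ linner M M = r ^+ 2 - 1.
Proof.
move=> NE TT TN NN; have -> : M = N - r *: T by rewrite NE addrK.
by rewrite !linnerE (linnerC N T) TT TN NN; split; ring.
Qed.

(** Since T x T = 0, [v T] is M + (r - e s) T + e c T x M. The mixed terms of the product are
    determinants that vanish or cancel by antisymmetry; the product of the two cross products
    expands by Lagrange's identity. *)
Lemma linner_frame (M T1 T2 : lvec R) (r c s e : R) :
    linner T1 M = - r -> linner T2 M = - r -> linner M M = r ^+ 2 - 1 ->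
    c ^+ 2 + s ^+ 2 = 1 -> e ^+ 2 = 1 ->
  let v T := (M + r *: T) + e *: (- s *: T + c *: lcross T (M + r *: T)) in
  linner (v T1) (v T2) = (1 - e * r * s) ^+ 2 * (linner T1 T2 - 1).
Proof.
move=> T1M T2M MM cs ee v.
have -> : linner (v T1) (v T2) = linner M M
    + (r - e * s) * (linner T1 M + linner T2 M)
    + (r - e * s) ^+ 2 * linner T1 T2
    + e ^+ 2 * c ^+ 2 * (linner T1 M * linner T2 M - linner T1 T2 * linner M M).
  by rewrite /v /linner /lcross !coordE; ring.
have c2 : c ^+ 2 = 1 - s ^+ 2 by rewrite -cs addrK.
rewrite T1M T2M MM c2.
transitivity (r ^+ 2 - 1 + (r - e * s) * (- r + - r) +
  (r ^+ 2 - 2 * r * e * s + e ^+ 2 * s ^+ 2) * linner T1 T2 +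
  e ^+ 2 * (1 - s ^+ 2) * (- r * - r - linner T1 T2 * (r ^+ 2 - 1))).
  by ring.
transitivity ((1 - 2 * e * r * s + e ^+ 2 * r ^+ 2 * s ^+ 2) * (linner T1 T2 - 1)).
  by rewrite ee; ring.
by ring.
Qed.

End LorentzAlgebra.

(** * Frames of a Koebe isothermic net *)

Section Koebe.
Variable R : realType.
Implicit Types (h : snet R) (C : lcircle R) (p t : lvec R) (S : osphere R).

(* With c0 the centre of C in its plane and a = p - c0, the points c0 +- u,
   where u is the multiple of t with <u,u> = <a,a>, lie on C, hence in U_+;
   subtracting their equations gives <c0,t> = 0. *)
Lemma Uplus_circle_tangent C p t :
    spacelike_circle C -> (forall x, on_circle C x -> Uplus x) ->
    on_circle C p -> tangent_circle C p t -> 0 < linner t t ->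
  linner p t = 0.
Proof.
case=> r0 nn CU [pS pn] [nt pt] tt.
set n := cnormal C in nn pn nt *; set m := centre (csphere C) in pt pS *.
set r := srad (csphere C) in r0 pS *.
have nn0 : linner n n != 0 by rewrite lt_eqF.
pose k := (coffset C - linner n m) / linner n n.
have kE : k * linner n n = coffset C - linner n m by rewrite /k divfK.
pose c0 := m + k *: n.
(* By Pythagoras this is <a,a>; it is positive because n is timelike. *)
pose a2 := r ^+ 2 - k ^+ 2 * linner n n.
have a2_gt0 : 0 < a2.
  have r2 : 0 < r ^+ 2 by rewrite exprn_even_gt0.
  have : k ^+ 2 * linner n n <= 0 by rewrite mulr_ge0_le0 ?sqr_ge0 // ltW.
  by rewrite /a2; lra.
pose u := Num.sqrt (a2 / linner t t).
have uE : u ^+ 2 * linner t t = a2.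
  by rewrite /u sqr_sqrtr ?divfK ?gt_eqF // divr_ge0 // ltW.
have u0 : u != 0.
  by apply: contraTneq a2_gt0 => e; rewrite -uE e expr0n /= mul0r ltxx.
have onC v : v ^+ 2 * linner t t = a2 -> on_circle C (c0 + v *: t).
  move=> vE; split.
    rewrite /on_sphere -/m -/r.
    have -> : c0 + v *: t - m = k *: n + v *: t.
      by apply: lvecP; rewrite /c0 !coordE; ring.
    transitivity (k ^+ 2 * linner n n + 2 * k * v * linner n t + v ^+ 2 * linner t t).
      by rewrite !linnerE (linnerC t n); ring.
    by rewrite nt vE /a2; ring.
  rewrite -/n /c0 !linnerE nt kE; ring.
have [e1 _] := CU _ (onC u uE).
have [e2 _] := CU _ (onC (- u) ltac:(by rewrite sqrrN)).
have c0t : linner c0 t = 0.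
  have : 4 * u * linner c0 t = 0.
    transitivity (linner (c0 + u *: t) (c0 + u *: t)
                - linner (c0 + (- u) *: t) (c0 + (- u) *: t)).
      by rewrite /linner !coordE; ring.
    by rewrite e1 e2 subrr.
  by move/eqP; rewrite !mulf_eq0 pnatr_eq0 (negPf u0) /= => /eqP.
have : linner p t = linner (p - m) t + linner c0 t - k * linner n t.
  by rewrite /c0 !linnerE; ring.
by rewrite pt c0t nt mulr0 subr0 addr0.
Qed.

Lemma frameTC h w w' : frameT h w' w = - frameT h w w'.
Proof.
rewrite /frameT -(opprB (centre (hw h w)) (centre (hw h w'))) scalerN opprK.
rewrite /lnorm linnerNl linnerNr opprK.
by rewrite -(opprB (centre (hw h w')) (centre (hw h w))) linnerNl linnerNr opprK.
Qed.

Lemma frameBphiC h phi f w w' : frameBphi h phi f w' w = - frameBphi h phi f w w'.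
Proof.
rewrite /frameBphi /frameB frameTC.
by apply: lvecP; rewrite /lcross !coordE; ring.
Qed.

(** The black vertex b supplies a circle in U_+ through h(f), orthogonal there to the white sphere;
    its tangent is thus along T, whence T is orthogonal to N. That h(f) lies between the centres
    fixes the sign in N = M + r T. *)
Lemma koebe_frame h f w w' b :
    koebe_isothermic h -> white_edge f w w' -> black b -> incident b f ->
  [/\ 0 < hrad h w,
      hf h f = centre (hw h w) + hrad h w *: frameT h w w',
      linner (frameT h w w') (frameT h w w') = 1,
      linner (frameT h w w') (hf h f) = 0 &
      linner (hf h f) (hf h f) = -1].
Proof.
move=> [[tl sc _ orth] CU btw] e bb bf.
have /and5P[ww _ _ wf _] := e.
have [t [t0 t1 fE]] := btw _ _ _ e.
have [pC pS tg] := orth _ _ _ ww bb wf bf.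
set d := centre (hw h w') - centre (hw h w).
have NM : hf h f - centre (hw h w) = t *: d.
  by rewrite fE; apply: lvecP; rewrite /d !coordE; ring.
have TE : frameT h w w' = (lnorm d)^-1 *: d by [].
have R0 : 0 < hrad h w by rewrite normr_gt0 (tl _ ww).
have R2 : t ^+ 2 * linner d d = hrad h w ^+ 2.
  rewrite /hrad real_normK ?num_real // -pS NM !linnerE; ring.
have dd : 0 < linner d d.
  have : 0 < t ^+ 2 * linner d d by rewrite R2 exprn_gt0.
  by rewrite pmulr_rgt0 // exprn_gt0.
have ld : 0 < lnorm d by rewrite sqrtr_gt0.
have ld2 : lnorm d ^+ 2 = linner d d by rewrite sqr_sqrtr // ltW.
have tR : hrad h w = t * lnorm d.
  apply/eqP; rewrite -(eqrXn2 (n := 2)) //; first last.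
  - by rewrite mulr_ge0 // ltW.
  - exact: ltW.
  by rewrite exprMn ld2 R2.
have tang : linner (hf h f) (hf h f - centre (hw h w)) = 0.
  apply: (Uplus_circle_tangent (sc _ bb) (CU _ bb) pC tg).
  by rewrite pS exprn_even_gt0 //=; exact: (tl _ ww).
have [NN _] := CU _ bb _ pC.
split=> //.
- rewrite -[LHS](subrK (centre (hw h w))) NM addrC; congr (_ + _).
  by rewrite tR TE scalerA mulfK // gt_eqF.
- rewrite TE linnerZl linnerZr -ld2.
  by rewrite mulrA -expr2 exprVn mulVf // sqrf_eq0 gt_eqF.
- rewrite TE linnerZl linnerC.
  move: tang; rewrite NM linnerZr => /eqP.
  by rewrite mulf_eq0 gt_eqF //= => /eqP ->; rewrite mulr0.
Qed.

End Koebe.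

(** * Contact points and relative positions of centres *)

Section Contacts.
Variable R : realType.
Implicit Types (S : osphere R) (l : oline R) (p q v T : lvec R).

Lemma touch_at_sym S S' q : srad S' != 0 -> touch_at S S' q -> touch_at S' S q.
Proof.
move=> r0 [qS qS' [k kE]]; split=> //; exists k^-1.
(* For k = 0 the point q would be the centre of S', although it lies on this sphere of nonzero
   radius. *)
have k0 : k != 0.
  apply: contraNneq r0 => k0; move: qS'; rewrite /on_sphere kE k0 scale0r.
  by move/esym/eqP; rewrite /linner !coordE !mul0r addr0 subrr sqrf_eq0.
by rewrite kE scalerA mulVf // scale1r.
Qed.

(** The normals at q are parallel and the centres differ, so q - m = a T for some a. Then a^2 = r^2
    and (a - e (r + r'))^2 = r'^2 force e a = r. *)
Lemma touch_point S S' q T (e r r' : R) :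
    linner T T = 1 -> e ^+ 2 = 1 -> 0 < r -> 0 < r' ->
    `|srad S| = r -> `|srad S'| = r' ->
    centre S' - centre S = (e * (r + r')) *: T ->
    touch_at S S' q ->
  q - centre S = (e * r) *: T.
Proof.
move=> TT ee r0 r0' rS rS' cc [qS qS' [k kE]].
have dE : (1 - k) *: (q - centre S) = (e * (r + r')) *: T.
  by rewrite -cc scalerBl scale1r -kE; apply: lvecP; rewrite !coordE; ring.
have e0 : e != 0 by apply: contra_eq_neq ee => ->; rewrite expr0n /= eq_sym oner_eq0.
have k1 : 1 - k != 0.
  apply: contra_eq_neq TT => k0; move: dE; rewrite k0 scale0r => /esym dE.
  have : (e * (r + r')) * linner T T = 0.
    by rewrite -linnerZl dE /linner !coordE; ring.
  move/eqP; rewrite !mulf_eq0 (negPf e0) gt_eqF ?addr_gt0 //= => /eqP ->.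
  by rewrite eq_sym oner_eq0.
pose a := (e * (r + r')) / (1 - k).
have qE : q - centre S = a *: T.
  by rewrite /a mulrC -scalerA -dE scalerA mulVf // scale1r.
have qE' : q - centre S' = (a - e * (r + r')) *: T.
  by rewrite scalerBl -qE -cc; apply: lvecP; rewrite !coordE; ring.
have a2 : a ^+ 2 = r ^+ 2.
  rewrite -rS real_normK ?num_real // -qS qE linnerZl linnerZr TT; ring.
have b2 : (a - e * (r + r')) ^+ 2 = r' ^+ 2.
  rewrite -[in RHS]rS' real_normK ?num_real // -qS' qE' linnerZl linnerZr TT; ring.
rewrite qE; congr (_ *: _).
have : e * a * (r + r') = r * (r + r').
  have : a ^+ 2 - 2 * (e * a * (r + r')) + e ^+ 2 * (r + r') ^+ 2 = r' ^+ 2.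
    by rewrite -b2; ring.
  by rewrite a2 ee; nra.
have rr : r + r' != 0 by rewrite gt_eqF ?addr_gt0.
move/(mulIf rr) => <-.
by rewrite mulrA -expr2 ee mul1r.
Qed.

(** Subtracting the two contact conditions gives m' - m = (R - R') nu modulo v, and q - m = R nu
    modulo v expresses nu through T. Pairing with N excludes v = 0. *)
Lemma line_offset S S' l q v (N : lvec R) (r e : R) T :
    linner N v != 0 -> srad S != 0 ->
    line_contact S l -> line_contact S' l -> is_line l q v ->
    q - centre S = (e * r) *: T ->
  exists s : R, centre S' - centre S
    = (e * (r * (1 - srad S' / srad S))) *: T + s *: v.
Proof.
move=> Nv r0 [s1 c1] [s2 c2] [[s3 qE] [k vE]] qS.
have k0 : k != 0.
  apply: contraNneq Nv => k0; rewrite vE k0 scale0r /linner !coordE; apply/eqP; ring.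
have lE : ldir l = k^-1 *: v by rewrite vE scalerA mulVf // scale1r.
have nuE : lnu (ldir l) = (srad S)^-1 *: ((e * r) *: T - (s1 + s3) *: ldir l).
  rewrite -qS qE -[RHS]scale1r; apply: (scalerI r0).
  rewrite scale1r [in RHS]scalerA mulfV // scale1r.
  transitivity (lpoint l - centre S - s1 *: ldir l).
    by rewrite c1 addrK.
  by apply: lvecP; rewrite !coordE; ring.
have -> : centre S' - centre S
  = (srad S - srad S') *: lnu (ldir l) + (s1 - s2) *: ldir l.
  transitivity ((lpoint l - centre S) - (lpoint l - centre S')).
    by apply: lvecP; rewrite !coordE; ring.
  by rewrite c1 c2; apply: lvecP; rewrite !coordE; ring.
exists (((s1 - s2) - (srad S - srad S') / srad S * (s1 + s3)) * k^-1).
rewrite nuE -(scalerA _ k^-1) -lE.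
by apply: lvecP; rewrite !coordE; field.
Qed.
End Contacts.

(** * Cross-ratios and Gram matrices of isotropic vectors *)

Section CrossRatio.

Definition wedge (F : fieldType) (p h : 'I_4 -> F) i j : F := p i * h j - p j * h i.

(** If F = A - D, then -A/D = (F^2 - A^2 - D^2) / (2 D^2), so squares suffice. Here A, D, F are
    products of two wedges, whose squares are Gram products up to a common factor. *)
Definition signed_cross_ratio (F : fieldType) (g : 'I_4 -> 'I_4 -> F) : F :=
  (g 0 2 * g 1 3 - g 0 1 * g 2 3 - g 3 0 * g 1 2) / (2 * (g 3 0 * g 1 2)).

(* The left-hand side is minus a cross-ratio of the points p i / h i, and the
   Pluecker relation wedge 0 1 * wedge 2 3 - wedge 3 0 * wedge 1 2
   = wedge 0 2 * wedge 1 3 expresses it through the squares of the wedges. *)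
Lemma cross_ratio_gram (F : fieldType) (p h z t : 'I_4 -> F) (k : F)
    (g : 'I_4 -> 'I_4 -> F) :
    2 != 0 :> F -> k != 0 -> (forall i, p i != 0) ->
    (forall i, z i * h i = p i * (t i + (-1) ^+ i * k)) ->
    (forall i, z i * h (i + 3) = p (i + 3) * (t i - (-1) ^+ i * k)) ->
    (forall i j, wedge p h i j ^+ 2 = 2 * g i j * (p i * p j)) ->
  - ((z 0 * z 2) / (z 1 * z 3)) = signed_cross_ratio g
  /\ g 3 0 * g 1 2 != 0.
Proof.
move=> two k0 p0 zh zh3 E2.
set E := wedge p h.
(* The index i + 3 is i - 1 modulo 4. Eliminating t i from the two relations determines z i by the
   wedge of neighbouring directions. *)
have zE i : z i * E (i + 3) i = 2 * ((-1) ^+ i * k) * (p i * p (i + 3)).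
  rewrite /E /wedge mulrBr.
  rewrite !(mulrCA (z i)) zh zh3; ring.
(* The right-hand side of [zE] is nonzero, so none of the denominators below vanishes. *)
have zn i : z i != 0 /\ E (i + 3) i != 0.
  have : z i * E (i + 3) i != 0.
    by rewrite zE !mulf_neq0 ?p0 // signr_eq0.
  by rewrite mulf_eq0 negb_or => /andP.
have i1 : 1 + 3 = 0 :> 'I_4 by apply: val_inj.
have i2 : 2 + 3 = 1 :> 'I_4 by apply: val_inj.
have i3 : 3 + 3 = 2 :> 'I_4 by apply: val_inj.
have [z0 e0] := zn 0; have [z1 e1] := zn 1; have [z2 e2] := zn 2; have [z3 e3] := zn 3.
move: (zE 0) (zE 1) (zE 2) (zE 3) e0 e1 e2 e3.
rewrite !add0r i1 i2 i3 /= !expr0 expr1 sqrrN expr1n exprS sqrrN expr1n !mulr1 !mul1r.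
move=> zE0 zE1 zE2 zE3 e0 e1 e2 e3.
have zz0 : z 0 = 2 * k * (p 0 * p 3) / E 3 0 by rewrite -zE0 mulfK.
have zz1 : z 1 = 2 * (- 1 * k) * (p 1 * p 0) / E 0 1 by rewrite -zE1 mulfK.
have zz2 : z 2 = 2 * k * (p 2 * p 1) / E 1 2 by rewrite -zE2 mulfK.
have zz3 : z 3 = 2 * (- 1 * k) * (p 3 * p 2) / E 2 3 by rewrite -zE3 mulfK.
have X : - ((z 0 * z 2) / (z 1 * z 3)) = - (E 0 1 * E 2 3) / (E 3 0 * E 1 2).
  rewrite zz0 zz1 zz2 zz3; field.
  by rewrite two k0 e0 e1 e2 e3 !p0 oppr_eq0 oner_eq0.
have pl : E 0 1 * E 2 3 - E 3 0 * E 1 2 = E 0 2 * E 1 3.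
  by rewrite /E /wedge; ring.
(* Each of the three products in the Pluecker relation involves every index once, so their squares
   share the factor Q. *)
pose Q := 4 * (p 0 * p 1 * p 2 * p 3).
have sq i j l m : p i * p j * (p l * p m) = p 0 * p 1 * p 2 * p 3 ->
    (E i j * E l m) ^+ 2 = Q * (g i j * g l m).
  by move=> e; rewrite exprMn !E2 /Q -e; ring.
have A2 := sq 0 1 2 3 ltac:(ring).
have D2 := sq 3 0 1 2 ltac:(ring).
have F2 := sq 0 2 1 3 ltac:(ring).
have Q0 : Q != 0.
  rewrite /Q (_ : 4 = 2 * 2); last by ring.
  by rewrite !mulf_neq0.
have g0 : g 3 0 * g 1 2 != 0.
  have : (E 3 0 * E 1 2) ^+ 2 != 0 by rewrite expf_neq0 // mulf_neq0.
  by rewrite D2 mulf_eq0 negb_or => /andP[].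
split=> //.
rewrite X /signed_cross_ratio; apply/eqP.
rewrite eqr_div ?(mulf_neq0 e0 e2) ?(mulf_neq0 two g0) //.
rewrite -(inj_eq (mulfI Q0)); apply/eqP.
transitivity (- 2 * (E 0 1 * E 2 3) * (Q * (g 3 0 * g 1 2))); first by ring.
transitivity ((Q * (g 0 2 * g 1 3) - Q * (g 0 1 * g 2 3) - Q * (g 3 0 * g 1 2))
   * (E 3 0 * E 1 2)); last by ring.
by rewrite -A2 -D2 -F2 -pl; ring.
Qed.

Lemma signed_cross_ratioZ (F : fieldType) (a : F) (g : 'I_4 -> 'I_4 -> F) :
  a != 0 -> 2 != 0 :> F -> g 3 0 * g 1 2 != 0 ->
  signed_cross_ratio (fun i j => a * g i j) = signed_cross_ratio g.
Proof.
move=> a0 two; rewrite mulf_eq0 negb_or => /andP[g0 g1].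
by rewrite /signed_cross_ratio; field; rewrite a0 g0 g1 two.
Qed.

Variable R : realType.
Implicit Types (v x T : lvec R).

Lemma proj_isotropic_eq0 v : linner v v = 0 -> (proj v == 0) = (v == 0).
Proof.
move=> vv; apply/eqP/eqP => [|->]; last by rewrite /proj !mxE.
move=> [v0 v1]; have v2 : v 0 2 = 0.
  move/eqP: vv; rewrite /linner v0 v1 !mul0r add0r sub0r oppr_eq0 mulf_eq0 orbb.
  by move/eqP.
by apply: lvecP; rewrite ?v0 ?v1 ?v2 mxE.
Qed.

(** For isotropic v, the square of the third coordinate is the projection times its conjugate;
    expanding the square then produces the conjugates that occur in 2 <v,v'>. *)
Lemma proj_wedge_sqr v v' : linner v v = 0 -> linner v' v' = 0 ->
  (proj v * (v' 0 2)%:C - proj v' * (v 0 2)%:C) ^+ 2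
  = 2 * (linner v v')%:C * (proj v * proj v').
Proof.
have H x : linner x x = 0 -> ((x 0 2)%:C) ^+ 2 = proj x * (proj x)^*%C.
  move=> xx; have e : x 0 2 ^+ 2 = x 0 0 ^+ 2 + x 0 1 ^+ 2.
    by apply/eqP; rewrite -subr_eq0 -oppr_eq0 -xx /linner; apply/eqP; ring.
  by rewrite -rmorphXn /= e; apply/eqP; rewrite eq_complex /=; apply/andP; split; apply/eqP; ring.
have G : 2 * (linner v v')%:C
    = proj v * (proj v')^*%C + proj v' * (proj v)^*%C - 2 * (v 0 2)%:C * (v' 0 2)%:C.
  have -> : 2 = 2%:C :> R[i] by rewrite rmorph_nat.
  by apply/eqP; rewrite eq_complex /= /linner; apply/andP; split; apply/eqP; ring.
move=> /H hv /H hv'; rewrite G.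
transitivity (proj v ^+ 2 * (v' 0 2)%:C ^+ 2 + proj v' ^+ 2 * (v 0 2)%:C ^+ 2
  - 2 * (v 0 2)%:C * (v' 0 2)%:C * (proj v * proj v')); first by ring.
by rewrite hv hv'; ring.
Qed.

(** In complex form, the first two coordinates of T x v = e v say that proj T * v_3 - proj v * T_3 =
    i e proj v. *)
Lemma proj_ruling v T x (e k s : R) :
    lcross T v = e *: v -> x = k *: T + s *: v ->
  proj x * (v 0 2)%:C = proj v * ((x 0 2)%:C + (e * k)%:C * 'i).
Proof.
move=> Tv ->.
have := congr1 (fun u : lvec R => u 0 0) Tv.
have := congr1 (fun u : lvec R => u 0 1) Tv.
rewrite /lcross !coordE => e1 e0.
apply/eqP; rewrite eq_complex /=; apply/andP; split; rewrite !mxE; apply/eqP.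
  transitivity (k * (T 0 2 * v 0 0 - (T 0 2 * v 0 0 - T 0 0 * v 0 2)) + s * v 0 0 * v 0 2).
    by ring.
  by rewrite e1; ring.
transitivity (k * (T 0 2 * v 0 1 + (T 0 1 * v 0 2 - T 0 2 * v 0 1)) + s * v 0 1 * v 0 2).
  by ring.
by rewrite e0; ring.
Qed.

End CrossRatio.

(** * Faces and neighbours around a white vertex *)

Section Combinatorics.
Implicit Types (w : vertex) (i : 'I_4).

Definition opp_white w i : vertex :=
  w + nth 0 [:: (1, 1); (-1, 1); (-1, -1); (1, -1)] i.

(** This and the next lemmas translate the numbering around the black vertex [nbr w i] into the one
    around w, with indices modulo 4. *)
Lemma nbr_nbr2 w i : nbr (nbr w i) (i + 2) = w.
Proof.
rewrite /nbr -addrA -[RHS]addr0; congr (_ + _).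
by case: i => [[|[|[|[|//]]]] ?].
Qed.

Lemma nbr_nbr1 w i : nbr (nbr w i) (i + 1) = opp_white w i.
Proof.
rewrite /nbr -addrA; congr (_ + _).
by case: i => [[|[|[|[|//]]]] ?].
Qed.

Lemma nbr_nbr3 w i : nbr (nbr w i) (i + 3) = opp_white w (i + 3).
Proof.
rewrite /nbr -addrA; congr (_ + _).
by case: i => [[|[|[|[|//]]]] ?].
Qed.

Lemma nbr_face1 w i : nbr_face (nbr w i) (i + 1) = nbr_face w i.
Proof.
rewrite /nbr /nbr_face -addrA; congr (_ + _).
by case: i => [[|[|[|[|//]]]] ?].
Qed.

Lemma nbr_face2 w i : nbr_face (nbr w i) (i + 2) = nbr_face w (i + 3).
Proof.
rewrite /nbr /nbr_face -addrA; congr (_ + _).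
by case: i => [[|[|[|[|//]]]] ?].
Qed.

Lemma ordSE i : ordS i = i + 1.
Proof. by apply: val_inj; case: i => [[|[|[|[|//]]]] ?]. Qed.

Lemma black_nbr w i : white w -> black (nbr w i).
Proof.
rewrite /white /black /nbr; case: w => a b.
by case: i => [[|[|[|[|//]]]] ?] /=; lia.
Qed.

Lemma white_edge_opp w i : white w -> white_edge (nbr_face w i) w (opp_white w i).
Proof.
move=> ww; rewrite /white_edge ww /=; apply/and4P; split.
- move: ww; rewrite /white /black /opp_white; case: w => a b.
  by case: i => [[|[|[|[|//]]]] ?] /=; lia.
- rewrite -subr_eq0 /opp_white opprD addNKr.
  by case: i => [[|[|[|[|//]]]] ?].
- rewrite /incident !inE /nbr_face -!addrA -{1 3 5 7}[w]addr0 !(inj_eq (addrI w)).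
  by case: i => [[|[|[|[|//]]]] ?].
- rewrite /incident !inE /nbr_face /opp_white -!addrA !(inj_eq (addrI w)).
  by case: i => [[|[|[|[|//]]]] ?].
Qed.

Lemma incident_nbr w i : incident (nbr w i) (nbr_face w i).
Proof.
rewrite /incident !inE /nbr_face /nbr -!addrA !(inj_eq (addrI w)).
by case: i => [[|[|[|[|//]]]] ?].
Qed.

Lemma incident_nbr3 w i : incident (nbr w i) (nbr_face w (i + 3)).
Proof.
rewrite /incident !inE /nbr_face /nbr -!addrA !(inj_eq (addrI w)).
by case: i => [[|[|[|[|//]]]] ?].
Qed.

Lemma horizontal_opp w i : horizontal w (opp_white w i) = ~~ odd i.
Proof.
rewrite /horizontal /opp_white addrAC subrr add0r.
by case: i => [[|[|[|[|//]]]] ?].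
Qed.
End Combinatorics.

(** The sum is taken modulo 4; as 4 is even, the wrap-around from 3 to 0 respects the sign. *)
Lemma sign_ord1 (F : pzRingType) (i : 'I_4) : (-1) ^+ (i + 1)%R = - (-1) ^+ i :> F.
Proof.
by case: i => [[|[|[|[|//]]]] ?]; rewrite /= ?expr0 ?exprS ?mulN1r ?opprK.
Qed.

(** * The congruence around one white vertex *)

Section Star.
Variables (R : realType) (h : snet R) (s : vertex -> bool) (phi : R).
Variables (c cd : congruence R) (w : vertex).
Hypotheses (kh : koebe_isothermic h) (ac : associated_congruence h s phi c).
Hypotheses (off : null_offset c cd) (ww : white w).
Implicit Types (i j : 'I_4) (e : R).

Let u i := opp_white w i.
Let f i := nbr_face w i.
Let b i := nbr w i.
Let T i := frameT h w (u i).
Let N i := hf h (f i).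
Let Tphi i := frameTphi h phi (f i) w (u i).
Let v e i := N i + e *: frameBphi h phi (f i) w (u i).
Let eps i : R := (-1) ^+ (s (b i) + i).
Let r := hrad h w.

Let ord4 i : i + 1 + 3 = i.
Proof. by rewrite -addrA (_ : 1 + 3 = 0) ?addr0 //; exact: val_inj. Qed.

Let frame i : [/\ 0 < r, N i = centre (hw h w) + r *: T i,
  linner (T i) (T i) = 1, linner (T i) (N i) = 0 & linner (N i) (N i) = -1].
Proof. exact: koebe_frame kh (white_edge_opp i ww) (black_nbr i ww) (incident_nbr w i). Qed.

Let opp_rad i : 0 < hrad h (u i).
Proof.
have e := white_edge_opp i ww.
have [[tl _ _ _] _ _] := kh.
by rewrite normr_gt0 tl //; case/and5P: e.
Qed.

Let TphiT i : linner (Tphi i) (Tphi i) = 1.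
Proof.
have [_ _ TT TN NN] := frame i.
exact: linner_rotation TT NN TN (cos2Dsin2 phi).
Qed.

Let Nv e i : linner (N i) (v e i) = -1.
Proof.
have [_ _ _ TN NN] := frame i.
exact: linner_frame_normal NN TN.
Qed.

(** Seen from [b i], this face has index i + 1 and its edge runs from [u i] to w. Reversing the edge
    negates B^phi, which compensates for the extra sign; in [line_prev] the index is i + 2 and the
    edge already leaves w. *)
Let line_next i : exists q,
  touch_at (cs c w) (cs c (u i)) q /\ is_line (cl c (f i)) q (v (eps i) i).
Proof.
have [_ [_ rS _] _ lines] := ac.
have := lines _ (black_nbr i ww) (i + 1); cbv zeta.
have -> : ordS (i + 1) = i + 2 by rewrite ordSE -addrA.
rewrite nbr_nbr1 nbr_nbr2 nbr_face1 => -[q [tq lq]]; exists q.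
rewrite exprD sign_ord1 mulrN -exprD frameBphiC scaleNr scalerN opprK in lq.
split=> //; apply: touch_at_sym tq.
have [r0 _ _ _ _] := frame i.
by rewrite -normr_eq0 rS // invr_eq0 gt_eqF.
Qed.

Let line_prev i : exists q,
  touch_at (cs c w) (cs c (u (i + 3))) q /\
  is_line (cl c (f (i + 3))) q (v (eps i) (i + 3)).
Proof.
have [_ _ _ lines] := ac; have := lines _ (black_nbr i ww) (i + 2); cbv zeta.
have -> : ordS (i + 2) = i + 3.
  by rewrite ordSE -addrA; congr (_ + _); exact: val_inj.
rewrite nbr_nbr3 nbr_nbr2 nbr_face2 => -[q [tq lq]]; exists q; split=> //.
have i2 : i + 2 = i + 1 + 1 by rewrite -addrA.
by move: lq; rewrite exprD i2 !sign_ord1 opprK -exprD.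
Qed.

(* If the signs differed, the line at f i would contain both directions
   N + B and N - B, hence the timelike vector N. *)
Let eps_next i : eps (i + 1) = eps i.
Proof.
have [q [_ [_ [k kE]]]] := line_next i.
have [q' [_]] := line_prev (i + 1); rewrite ord4 => -[_ [k' kE']].
apply/eqP; apply: contraT => ne.
have eN : eps (i + 1) = - eps i.
  move: ne; rewrite /eps -!(signr_odd _ (_ + _)%N).
  by case: odd; case: odd; rewrite ?eqxx ?expr0 ?expr1 ?opprK.
have [[iso _] _ _ _] := ac; have [l0 _] := iso (f i).
have [_ _ _ _ NN] := frame i.
have NE : N i = ((k + k') / 2) *: ldir (cl c (f i)).
  rewrite mulrC -scalerA scalerDl -kE -kE' eN /v.
  by move: (N i) (eps i) (frameBphi _ _ _ _ _) => n a B; apply: lvecP; rewrite !coordE; lra.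
have : linner (N i) (N i) = 0.
  by rewrite NE linnerZl linnerZr l0 !mulr0.
by rewrite NN => /eqP; rewrite oppr_eq0 oner_eq0.
Qed.

Let eps_const i : eps i = eps 0.
Proof.
have e1 : eps 1 = eps 0 by rewrite -(eps_next 0) add0r.
have e2 : eps 2 = eps 0 by rewrite -e1 -(eps_next 1).
have e3 : eps 3 = eps 0 by rewrite -e2 -(eps_next 2).
case: i => [[|[|[|[|//]]]] p].
- by congr (eps _); exact: val_inj.
- by rewrite -[RHS]e1; congr (eps _); exact: val_inj.
- by rewrite -[RHS]e2; congr (eps _); exact: val_inj.
- by rewrite -[RHS]e3; congr (eps _); exact: val_inj.
Qed.

Let e := eps 0.
Let C rho := r^-1 * (1 - rho / srad (cs c w)).

(** The edges at w are alternately horizontal and vertical, whence (-1)^i. Each black centre [b i]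
    is reached twice, along the lines at [f i] and [f (i + 3)]. *)
Let offset_line i (x : vertex) q :
    incident x (f i) ->
    touch_at (cs c w) (cs c (u i)) q -> is_line (cl c (f i)) q (v e i) ->
  exists a : R, centre (cs c x) - centre (cs c w)
    = ((-1) ^+ i * C (srad (cs c x))) *: Tphi i + a *: v e i.
Proof.
move=> xf tq lq.
have [[_ ct] [cc rS _] _ _] := ac.
have ed := white_edge_opp i ww; have /and5P[_ wu _ wf _] := ed.
have [r0 _ _ _ _] := frame i.
have es : edge_sign R w (u i) = (-1) ^+ i.
  by rewrite /edge_sign horizontal_opp if_neg -signr_odd; case: odd.
apply: (line_offset (N := N i) (r := r^-1) _ _ (ct _ _ wf) (ct _ _ xf) lq).
- by rewrite Nv oppr_eq0 oner_eq0.
- by rewrite -normr_eq0 rS // invr_eq0 gt_eqF.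
apply: (touch_point (TphiT i) _ _ _ (rS _ ww) (rS _ wu) _ tq).
- by rewrite -exprM mulnC exprM sqrrN !expr1n.
- by rewrite invr_gt0.
- by rewrite invr_gt0 opp_rad.
- by rewrite (cc _ _ _ ed) es.
Qed.

(** The right-hand side is free of phi. Since the offset keeps the centres, the computation takes
    place in c, whose lines are known explicitly. *)
Lemma Xvar_signed_cross_ratio :
  Xvar cd w = signed_cross_ratio
    (fun i j => (linner (frameT h w (opp_white w i)) (frameT h w (opp_white w j)) - 1)%:C).
Proof.
have [[cdn cdw cdb] [rho [rb cen]]] := off.
have [r0 _ _ _ _] := frame 0.
have [_ [_ rS _] _ _] := ac.
have ee : e ^+ 2 = 1 by rewrite /e /eps -exprM mulnC exprM sqrrN !expr1n.
have e0 : e != 0 by rewrite -sqrf_eq0 ee oner_eq0.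
have S0 : srad (cs c w) != 0 by rewrite -normr_eq0 rS // invr_eq0 gt_eqF.
(* Otherwise the white sphere of the null congruence at w would have radius 0. *)
have C0 : C rho != 0.
  rewrite /C mulf_neq0 ?invr_eq0 ?(gt_eqF r0) //.
  have := cdw _ ww; rewrite /timelike_sphere (cen w).2; apply: contraNneq => C0.
  have -> : srad (cs c w) - rho = srad (cs c w) * (1 - rho / srad (cs c w)) by field.
  by rewrite C0 mulr0.
have g i j : linner (v e i) (v e j)
    = (1 - e * r * sin phi) ^+ 2 * (linner (T i) (T j) - 1).
  have centreE l : linner (T l) (centre (hw h w)) = - r /\
      linner (centre (hw h w)) (centre (hw h w)) = r ^+ 2 - 1.
    have [_ NE TT TN NN] := frame l; exact: linner_frame_centre NE TT TN NN.
  have [TiM MM] := centreE i; have [TjM _] := centreE j.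
  rewrite -(linner_frame TiM TjM MM (cos2Dsin2 phi) ee) /v.
  rewrite /frameBphi /frameB /frameN -/(T i) -/(N i) -/(T j) -/(N j).
  by have [_ <- _ _ _] := frame i; have [_ <- _ _ _] := frame j.
have iso i : linner (v e i) (v e i) = 0.
  by rewrite g; have [_ _ -> _ _] := frame i; rewrite subrr mulr0.
have cross i : lcross (Tphi i) (v e i) = e *: v e i.
  have [_ _ TT TN NN] := frame i; exact: lcross_frame TT NN TN (cos2Dsin2 phi) ee.
pose y i := centre (cs c (b i)) - centre (cs c w).
have two : 2 != 0 :> R[i] by rewrite pnatr_eq0.
(* The constant k is the imaginary term of [proj_ruling]; its sign flips between the two lines
   through the i-th black centre because i and i + 3 have opposite parity. *)
have [] := @cross_ratio_gram _ (fun i => proj (v e i)) (fun i => (v e i 0 2)%:C)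
   (fun i => proj (y i)) (fun i => (y i 0 2)%:C) ((e * C rho)%:C * 'i)
   (fun i j => (linner (v e i) (v e j))%:C) two.
- by apply: mulf_neq0; rewrite eq_complex /= ?eqxx ?andbT ?oner_eq0 ?andbF // mulf_neq0.
- move=> i; rewrite proj_isotropic_eq0 //.
  apply: contra_eq_neq (Nv e i) => ->.
  by rewrite /linner !mxE !mulr0 addr0 subrr eq_sym oppr_eq0 oner_eq0.
- move=> i; have [q []] := line_next i; rewrite eps_const => tq lq.
  have [a] := offset_line (incident_nbr w i) tq lq.
  rewrite rb ?black_nbr // => /(proj_ruling (cross i)) ->.
  rewrite mulrCA !rmorphM /= rmorphXn rmorphN rmorph1 /=; ring.
- move=> i; have [q []] := line_prev i; rewrite eps_const => tq lq.
  have [a] := offset_line (incident_nbr3 w i) tq lq.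
  rewrite rb ?black_nbr // => /(proj_ruling (cross (i + 3))) ->.
  have -> : (-1) ^+ (i + 3)%R = - (-1) ^+ i :> R.
    by rewrite -{2}(ord4 i) (addrAC i 1 3) sign_ord1 opprK.
  rewrite mulrCA !rmorphM /= rmorphN rmorphXn rmorphN rmorph1 /=; ring.
- by move=> i j; exact: proj_wedge_sqr.
have projB x y' : proj x - proj y' = proj (x - y') :> R[i].
  by apply/eqP; rewrite eq_complex /= !mxE !eqxx.
have -> : - (proj (y 0) * proj (y 2) / (proj (y 1) * proj (y 3))) = Xvar cd w.
  by rewrite /Xvar /center_net !(cen _).1 !projB.
move=> -> g0.
have gE i j : (linner (v e i) (v e j))%:C
    = ((1 - e * r * sin phi) ^+ 2)%:C * (linner (T i) (T j) - 1)%:C.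
  by rewrite g rmorphM.
(* The nonzero Gram product forces 1 - e r sin phi to be nonzero, so this factor cancels. *)
rewrite !gE mulrACA in g0.
move: g0; rewrite mulf_eq0 negb_or => /andP[].
rewrite mulf_eq0 orbb => a0 g0.
rewrite -[RHS](signed_cross_ratioZ a0 two g0).
by rewrite /signed_cross_ratio !gE.
Qed.

End Star.

Theorem theorem11p2 (R : realType) (c : congruence R)
    (cd : R -> congruence R) :
  maximal_congruence c -> associated_null_family c cd ->
  forall w : vertex, white w ->
  forall phi psi : R, Xvar (cd phi) w = Xvar (cd psi) w.
Proof.
move=> _ [h [[kh _] [s fam]]] w ww phi psi.
have [c1 a1 o1] := fam phi; have [c2 a2 o2] := fam psi.
by rewrite (Xvar_signed_cross_ratio kh a1 o1 ww) (Xvar_signed_cross_ratio kh a2 o2 ww).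
Qed.
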